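(* Let $K$ be a finite simplicial complex of dimension $r$ with $r\ge 1$, and let $U_K=\max_{F\in S_r(K)}\ell_K(F)$, where $\ell_K(F)=\bigl|\bigcup_{E\in\partial F}N_K(E)\bigr|$. Then $$\lambda_{\max}\bigl(L^{\mathrm{up}}_{r-1}(K)\bigr)=U_K$$ if and only if there exists a nonzero vector $z\in\mathbb{R}^{B_r(K)}$ such that $\delta_K z=0$ and $z_{[F]}=0$ for every $F\in S_r(K)$ with $\ell_K(F)<U_K$.
   Context: A finite (abstract) simplicial complex is a collection of finite sets closed under inclusion; an $r$-face is a face of cardinality $r+1$; $S_r(K)$ is the set of $r$-faces of $K$; $V(K)$ is the vertex set; the dimension of $K$ is the maximum dimension of its faces. Chain groups and boundary: choose an orientation (an ordering of the vertices up to even permutation) for each face, written $[F]$. $C_r(K,\mathbb{R})$ is the real vector space with basis $B_r(K)=\{[F]:F\in S_r(K)\}$, with the inner product making $B_r(K)$ orthonormal. The boundary map $\partial_r:C_r(K,\mathbb{R})\to C_{r-1}(K,\mathbb{R})$ is $\partial_r[v_0,\ldots,v_r]=\sum_{j=0}^r(-1)^j[v_0,\ldots,\widehat{v_j},\ldots,v_r]$, and $\partial_r^*$ is its adjoint. The combinatorial $(r-1)$-up Laplacian is $L^{\mathrm{up}}_{r-1}(K)=\partial_r\partial_r^*$ acting on $C_{r-1}(K,\mathbb{R})$; $\lambda_{\max}$ denotes its largest eigenvalue. For an $r$-face $F$, $\partial F$ denotes the set of all $(r-1)$-faces contained in $F$. For an $(r-1)$-face $E$ of $K$, $N_K(E)=\{u\in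 V(K)\setminus E: E\cup\{u\}\in S_r(K)\}$. The number $\ell_K(F)$ is called the local number of $F$. Signs: for ordered finite sets $\tau\subseteq\sigma$, $([\sigma]:[\tau])$ is the sign of the permutation that sends the ordered set $\sigma$ to the ordered set $(\sigma\setminus\tau,\tau)$, where $\sigma\setminus\tau$ carries the order induced from $\sigma$. Local mapping: for a set $H\subseteq V(K)$ with $|H|=r+2$, let $K[H]=\{\sigma\in K:\sigma\subseteq H\}$. Let $$\mathcal{H}_K=\{H\subseteq V(K): |H|=r+2,\ |S_r(K[H])|\ge 2\},$$ fix an ordering $[H]$ of each $H\in\mathcal{H}_K$, and let $B_{r+1}(\mathcal{H}_K)=\{[H]:H\in\mathcal{H}_K\}$. The linear map $\delta_K:\mathbb{R}^{B_r(K)}\to\mathbb{R}^{B_{r+1}(\mathcal{H}_K)}$ is $$(\delta_K z)_{[H]}=\sum_{F\in S_r(K[H])}([H]:[F])\,z_{[F]} .$$ *)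

(* Defs.v *)
From HB Require Import structures.
From mathcomp Require Import all_boot all_order all_fingroup all_algebra.
From mathcomp Require Import reals.
Set Implicit Arguments.
Unset Strict Implicit.
Unset Printing Implicit Defensive.
Import GRing.Theory.
Local Open Scope ring_scope.

Section Complexes.
Variable V : finType.
Implicit Types (K : {set {set V}}) (E F H : {set V}) (r : nat).

Definition simplicial_complex K : Prop :=
  forall F E, F \in K -> E \subset F -> E \in K.

Definition vertices K : {set V} := [set v | [set v] \in K].

Definition faces K r : {set {set V}} := [set F in K | #|F| == r.+1].

(* The truncated predecessor identifies dimensions -1 and 0; these cases are
   only relevant to complexes without edges. *)
Definition dimension K : nat := \max_(F in K) #|F|.-1.

Definition facets K r F : {set {set V}} := [set E in faces K r.-1 | E \subset F].

(* N_K(E), for E an (r-1)-face. *)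
Definition neighbours K r E : {set V} :=
  [set u in vertices K :\: E | u |: E \in faces K r].

Definition local_number K r F : nat :=
  #|\bigcup_(E in facets K r F) neighbours K r E|.

Definition max_local_number K r : nat := \max_(F in faces K r) local_number K r F.

Definition induced K H : {set {set V}} := [set F in K | F \subset H].

Definition local_sets K r : {set {set V}} :=
  [set H : {set V} | [&& H \subset vertices K, #|H| == r.+2
                       & (2 <= #|faces (induced K H) r|)%N]].

(* An ordering of every finite set of vertices. Only those of the faces (giving
   their orientations) and of the members of local_sets K r are used; these
   families are disjoint when dimension K = r, and arbitrary orderings of
   their members extend to all sets. *)
Definition orderings (o : {set V} -> seq V) : Prop :=
  forall A, perm_eq (o A) (enum A).

(* The permutation sending the i-th entry of s to the i-th entry of t and fixing
   all other points; the default value 1 is not reached when s and t are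
   duplicate-free enumerations of the same set. *)
Definition reorder_perm (s t : seq V) : {perm V} :=
  insubd (1%g : {perm V}) [ffun x => nth x t (index x s)].

Lemma reorder_permE (s t : seq V) (x : V) : uniq s -> perm_eq s t ->
  reorder_perm s t x = nth x t (index x s).
Proof.
move=> us st; have ut : uniq t by rewrite -(perm_uniq st).
have sz := perm_size st.
rewrite /reorder_perm -pvalE /= val_insubd ifT ?ffunE //.
apply/injectiveP => y z; rewrite !ffunE.
have inE w : w \in s -> (index w s < size t)%N by rewrite -sz index_mem.
have outE w : w \notin s -> nth w t (index w s) = w.
  by move=> wNs; rewrite nth_default // -sz leqNgt index_mem.
have [ys|yNs] := boolP (y \in s); have [zs|zNs] := boolP (z \in s).
- rewrite (set_nth_default z) ?inE // => /eqP.
  rewrite nth_uniq ?inE // => /eqP eq_i.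
  by rewrite -(nth_index y ys) eq_i nth_index.
- rewrite (outE z zNs) => eq_z.
  by case/negP: zNs; rewrite (perm_mem st) -eq_z mem_nth ?inE.
- rewrite (outE y yNs) => eq_y.
  by case/negP: yNs; rewrite (perm_mem st) eq_y mem_nth ?inE.
- by rewrite !outE.
Qed.

End Complexes.

Section Chains.
Variables (R : realType) (V : finType).
Implicit Types (K : {set {set V}}) (o : {set V} -> seq V) (r : nat) (s t : seq V).

Definition reorder_sign s t : R := (-1) ^+ reorder_perm s t.

(* ([sigma] : [tau]) *)
Definition incidence (sigma tau : seq V) : R :=
  reorder_sign sigma ([seq x <- sigma | x \notin tau] ++ tau).

(* C_r(K, R) is 'rV[R]_#|faces K r|: coordinate i is the coefficient of the
   basis vector [F] = [o F], where F = enum_val i. Linear maps act on row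
   vectors by right multiplication. *)

(* The chain of an r-simplex listed as s, namely [F] or -[F] according to
   whether s is an even or odd rearrangement of o F, F the set of entries of s. *)
Definition simplex_chain K o r s : 'rV[R]_#|faces K r| :=
  \row_(i < #|faces K r|)
    (if [set x in s] == enum_val i then reorder_sign (o (enum_val i)) s else 0).

Definition boundary K o r : 'M[R]_(#|faces K r|, #|faces K r.-1|) :=
  \matrix_(i < #|faces K r|)
    let s := o (enum_val i) in
    \sum_(j < r.+1) (-1) ^+ j *: simplex_chain K o r.-1 (take j s ++ drop j.+1 s).

(* The basis being orthonormal, the adjoint is the transpose; for row vectors
   the composite "adjoint, then boundary" is the product in this order. *)
Definition up_laplacian K o q : 'M[R]_#|faces K q| :=
  (boundary K o q.+1)^T *m boundary K o q.+1.

Definition largest_eigenvalue n (A : 'M[R]_n) (a : R) : Prop :=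
  eigenvalue A a /\ forall b, eigenvalue A b -> b <= a.

Definition local_map K o r (z : 'rV[R]_#|faces K r|) : 'rV[R]_#|local_sets K r| :=
  \row_(j < #|local_sets K r|)
    \sum_(i < #|faces K r| | enum_val i \in faces (induced K (enum_val j)) r)
      incidence (o (enum_val j)) (o (enum_val i)) * z 0 i.

End Chains.

(* Main.v *)
Require Import Defs.
From mathcomp Require Import all_boot all_order all_fingroup all_algebra.
From mathcomp Require Import reals.
Set Implicit Arguments.
Unset Strict Implicit.
Unset Printing Implicit Defensive.
Import Order.TTheory GRing.Theory Num.Theory.
Local Open Scope ring_scope.

(** Write [B] for the boundary matrix from r-chains to (r-1)-chains and [M] for
    the matrix of the local map. The theorem comes from the identity
    [B B^T + M M^T = D], where [D] is the diagonal matrix of the local numbers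
    (lemma [boundary_local_decomposition]).

    On the diagonal, [B B^T] counts the [r+1] facets of [F] and [M M^T] counts
    the local sets containing [F]; the latter correspond to the vertices outside
    [F] that are neighbours of some facet, whereas each vertex of [F] is a
    neighbour of the opposite facet, so the total is the local number of [F].
    Off the diagonal, two r-faces share a facet [E] exactly when their union [H]
    has [r+2] elements, and the two resulting entries are opposite: passing from
    [H] to [E] through one face or through the other removes the same two
    vertices in opposite orders ([incidence_square]).

    The nonzero eigenvalues of the up Laplacian [B^T B] are those of [B B^T]. If
    [z B B^T = b z], pairing with [z] gives
      [b |z|^2 + |z M|^2 = sum_F l(F) z_F^2 <= U |z|^2],
    so [b <= U], and [b = U] forces [z M = 0] and [z_F = 0] wherever [l(F) < U].
    Conversely these two conditions give [z B B^T = z D = U z]. *)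

(** * Signs of reorderings *)

Section ReorderSigns.
Variables (R : realType) (V : finType).
Implicit Types (s t u a b : seq V) (v w : V).

Lemma reorder_signM s t u : uniq s -> perm_eq s t -> perm_eq t u ->
  reorder_sign R s t * reorder_sign R t u = reorder_sign R s u.
Proof.
move=> us st tu; have ut : uniq t by rewrite -(perm_uniq st).
have su := perm_trans st tu.
suff eqM : reorder_perm s u = (reorder_perm s t * reorder_perm t u)%g.
  by rewrite /reorder_sign eqM odd_permM signr_addb.
apply/permP => x; rewrite permM !reorder_permE //.
have [xs|xNs] := boolP (x \in s).
  have lt_t : (index x s < size t)%N by rewrite -(perm_size st) index_mem.
  by rewrite index_uniq //; apply: set_nth_default; rewrite -(perm_size tu).
rewrite (nth_default _ (s := t)); last first.
  by rewrite -(perm_size st) leqNgt index_mem.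
rewrite !nth_default //.
  by rewrite -(perm_size tu) leqNgt index_mem -(perm_mem st).
by rewrite -(perm_size su) leqNgt index_mem.
Qed.

Lemma perm_front a v b : perm_eq (a ++ v :: b) (v :: a ++ b).
Proof. by apply/permPl; exact: (perm_catCA a [:: v] b). Qed.

Lemma reorder_sign_sqr s t : reorder_sign R s t * reorder_sign R s t = 1.
Proof. by rewrite -expr2 sqrr_sign. Qed.

(** Both signs are those of one and the same permutation of the vertices: it
    fixes every vertex outside the lists, hence the common head. *)
Lemma reorder_sign_cons v s t : uniq (v :: s) -> perm_eq s t ->
  reorder_sign R (v :: s) (v :: t) = reorder_sign R s t.
Proof.
move=> /[dup] uvs /andP[vNs us] st.
rewrite /reorder_sign; congr (_ ^+ nat_of_bool (odd_perm _)).
apply/permP => x; rewrite !reorder_permE ?perm_cons //=.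
have [<-|//] := eqVneq v x.
by rewrite [RHS]nth_default // -(perm_size st) leqNgt index_mem.
Qed.

Lemma reorder_sign_swap v w s : uniq [:: v, w & s] ->
  reorder_sign R [:: v, w & s] [:: w, v & s] = -1.
Proof.
move=> uvws; have vw : v != w.
  by move: uvws; rewrite /= inE negb_or => /andP[/andP[]].
suff -> : reorder_sign R [:: v, w & s] [:: w, v & s] = (-1) ^+ tperm v w.
  by rewrite odd_tperm vw.
rewrite /reorder_sign; congr (_ ^+ nat_of_bool (odd_perm _)).
apply/permP => x; rewrite reorder_permE //; last first.
  exact: (perm_front [:: v]).
rewrite /=; have [<-|vx] := eqVneq v x; first by rewrite tpermL.
have [<-|wx] := eqVneq w x; first by rewrite tpermR.
rewrite tpermD //=; have [xs|xNs] := boolP (x \in s); first exact: nth_index.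
by rewrite nth_default // leqNgt index_mem.
Qed.

(** The vertex [v] reaches the front by passing the entries of [a] one at a
    time, each transposition contributing [-1]. *)
Lemma reorder_sign_front a v b : uniq (a ++ v :: b) ->
  reorder_sign R (a ++ v :: b) (v :: a ++ b) = (-1) ^+ size a.
Proof.
elim: a => [|x a IHa] /= uxa.
  by rewrite -(@reorder_signM _ (v :: b)) // reorder_sign_sqr.
have uxva : uniq [:: x, v & a ++ b].
  by rewrite -(perm_uniq (s1 := x :: a ++ v :: b)) //= perm_cons perm_front.
rewrite -(@reorder_signM _ [:: x, v & a ++ b]) ?perm_cons ?perm_front //; last first.
  exact: (perm_front [:: x]).
rewrite reorder_sign_cons ?perm_front // reorder_sign_swap // IHa; last by case/andP: uxa.
by rewrite exprSr.
Qed.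

Lemma incidence_cons v s t : uniq s -> perm_eq s (v :: t) ->
  incidence R s t = reorder_sign R s (v :: t).
Proof.
move=> us st; have /andP[vNt _] : uniq (v :: t) by rewrite -(perm_uniq st).
rewrite /incidence; suff -> : [seq x <- s | x \notin t] = [:: v] by [].
apply: perm_small_eq => //; rewrite (perm_trans (perm_filter _ st)) //= vNt.
by rewrite (eq_in_filter (a2 := pred0)) ?filter_pred0 // => x ->.
Qed.

Lemma incidence_sqr s t : incidence R s t * incidence R s t = 1.
Proof. exact: reorder_sign_sqr. Qed.

End ReorderSigns.

(** * Signs of faces *)

Section FaceSigns.
Variables (R : realType) (V : finType) (o : {set V} -> seq V).
Hypothesis ho : orderings o.
Implicit Types (A E F H : {set V}) (v w : V).

Lemma uniq_ordering A : uniq (o A).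
Proof. by rewrite (perm_uniq (ho A)) enum_uniq. Qed.

Lemma mem_ordering A : o A =i A.
Proof. by move=> x; rewrite (perm_mem (ho A)) mem_enum. Qed.

Lemma size_ordering A : size (o A) = #|A|.
Proof. by rewrite (perm_size (ho A)) -cardE. Qed.

Lemma ordering_setU1 v A : v \notin A -> perm_eq (o (v |: A)) (v :: o A).
Proof.
move=> vA; apply: uniq_perm; first exact: uniq_ordering.
  by rewrite /= mem_ordering vA uniq_ordering.
by move=> x; rewrite mem_ordering !inE mem_ordering.
Qed.

Lemma incidence_setU1 v A : v \notin A ->
  incidence R (o (v |: A)) (o A) = reorder_sign R (o (v |: A)) (v :: o A).
Proof. by move=> vA; apply/incidence_cons/ordering_setU1/vA/uniq_ordering. Qed.

(** Two successive incidences compose: the head [w] added to both orderings of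
    [v |: E] does not affect the second sign. *)
Lemma incidence_flag v w E : v \notin E -> w \notin v |: E ->
  incidence R (o (w |: (v |: E))) (o (v |: E)) * incidence R (o (v |: E)) (o E)
    = reorder_sign R (o (w |: (v |: E))) [:: w, v & o E].
Proof.
move=> vE wvE; have pvE := ordering_setU1 vE.
rewrite !incidence_setU1 // -(@reorder_sign_cons _ _ w (o (v |: E))) //; last first.
  by rewrite /= mem_ordering wvE uniq_ordering.
apply: reorder_signM; rewrite ?perm_cons //; first exact: uniq_ordering.
exact: ordering_setU1.
Qed.

(** The two flags from [E] to [H] order the two added vertices differently, so
    the product of all four incidences is [-1]. *)
Lemma incidence_square v w E : v \notin E -> w \notin E -> v != w ->
  let H := v |: (w |: E) in
  incidence R (o (v |: E)) (o E) * incidence R (o (w |: E)) (o E)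
    = - (incidence R (o H) (o (v |: E)) * incidence R (o H) (o (w |: E))).
Proof.
move=> vE wE vw H.
have wvE : w \notin v |: E by rewrite !inE negb_or eq_sym vw.
have vwE : v \notin w |: E by rewrite !inE negb_or vw.
have HE : w |: (v |: E) = H by rewrite setUCA.
have flagv := incidence_flag vE wvE; rewrite HE in flagv.
have flagw : incidence R (o H) (o (w |: E)) * incidence R (o (w |: E)) (o E)
    = - reorder_sign R (o H) [:: w, v & o E].
  rewrite incidence_flag // -/H.
  have uvw : uniq [:: w, v & o E].
    by rewrite /= inE negb_or eq_sym vw !mem_ordering wE vE uniq_ordering.
  rewrite -(@reorder_signM _ _ _ [:: w, v & o E]) //.
  - by rewrite reorder_sign_swap // mulrN1.
  - exact: uniq_ordering.
  - rewrite -HE (perm_trans (ordering_setU1 wvE)) // perm_cons.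
    exact: ordering_setU1.
  - exact: (perm_front [:: w]).
have prod_eq : (incidence R (o H) (o (v |: E)) * incidence R (o H) (o (w |: E)))
    * (incidence R (o (v |: E)) (o E) * incidence R (o (w |: E)) (o E)) = -1.
  by rewrite mulrACA flagv flagw mulrN reorder_sign_sqr.
set p := _ * incidence R (o H) (o (w |: E)) in prod_eq *.
have p1 : p * p = 1 by rewrite /p mulrACA !incidence_sqr mulr1.
by rewrite -[LHS]mul1r -p1 -mulrA prod_eq mulrN1.
Qed.

End FaceSigns.

(** * The boundary and local matrices *)

Lemma eq_setU1_of_subset (V : finType) (E F : {set V}) n :
  E \subset F -> #|E| = n -> #|F| = n.+1 -> exists2 v, v \notin E & F = v |: E.
Proof.
move=> EF cE cF; have /cards1P[v FDE] : #|F :\: E| == 1%N.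
  by rewrite cardsD (setIidPr EF) cE cF subSnn.
have vFE : v \in F :\: E by rewrite FDE set11.
exists v; first by move: vFE; rewrite inE => /andP[].
by rewrite setUC -FDE setUC -(setID F E) (setIidPr EF) setDUl setDv set0U setDDl
   setUid setUC.
Qed.

Section Matrices.
Variables (R : realType) (V : finType).
Variables (K : {set {set V}}) (o : {set V} -> seq V) (r : nat).
Hypotheses (hK : simplicial_complex K) (ho : orderings o).
Implicit Types (E F H : {set V}).

Lemma facesP n F : reflect (F \in K /\ #|F| = n.+1) (F \in faces K n).
Proof. by rewrite inE; apply: (iffP andP) => -[FK /eqP]. Qed.

Lemma face_subset_vertices F : F \in K -> F \subset vertices K.
Proof.
by move=> FK; apply/subsetP => v vF; rewrite inE (hK FK) // sub1set.
Qed.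

Lemma mem_added_vertex u F F' n :
  #|F| = n -> #|F'| = n -> F' != F -> F' \subset u |: F -> u \in F'.
Proof.
move=> cF cF' neqF sF'; apply: contraR neqF => uF'.
rewrite eqEcard cF cF' leqnn andbT; apply/subsetP => x xF'.
move/subsetP/(_ x xF'): sF'; rewrite !inE => /orP[/eqP xu|//].
by rewrite -xu xF' in uF'.
Qed.

(** Let [F = v |: E]. The incidence is the sign of reordering [F] into [v]
    followed by [E]. Moving [v] to the front costs the alternating sign of the
    boundary formula; the remaining factor compares the order that [F] induces
    on [E] with the chosen orientation of [E]. *)
Lemma boundaryE (i : 'I_#|faces K r.+1|) (k : 'I_#|faces K r|) :
  boundary R K o r.+1 i k
    = if enum_val k \subset enum_val i
      then incidence R (o (enum_val i)) (o (enum_val k)) else 0.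
Proof.
have /facesP[_ cF] := enum_valP i; have /facesP[_ cE] := enum_valP k.
move eF: (enum_val i) cF => F cF; move eE: (enum_val k) cE => E cE.
have supp a v b : o F = a ++ v :: b -> [set x in a ++ b] = F :\ v.
  move=> oF; apply/setP => x; rewrite !inE -(mem_ordering ho F) oF !mem_cat inE.
  have [->|//] := eqVneq x v.
  have := uniq_ordering ho F; rewrite oF cat_uniq /= negb_or -!andbA.
  by case/and5P=> _ /negbTE-> _ /negbTE->.
rewrite mxE summxE.
transitivity (\sum_(j < r.+2) (-1) ^+ j *
    (if [set x in take j (o F) ++ drop j.+1 (o F)] == E
     then reorder_sign R (o E) (take j (o F) ++ drop j.+1 (o F)) else 0)).
  by apply: eq_bigr => j _; rewrite !mxE eF eE.
have sF : size (o F) = r.+2 by rewrite (size_ordering ho).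
have [EF|NEF] := boolP (E \subset F); last first.
  apply: big1 => j _; case: eqP => [defE|]; last by rewrite mulr0.
  case/negP: NEF; apply/subsetP => x; rewrite -defE inE mem_cat => xs.
  rewrite -(mem_ordering ho F).
  by case/orP: xs => [/mem_take|/mem_drop].
have [v vE defF] := eq_setU1_of_subset EF cE cF.
have vF : v \in o F by rewrite mem_ordering // defF setU11.
have ltj : (index v (o F) < r.+2)%N by rewrite -sF index_mem.
have splitF (j : nat) : (j < r.+2)%N ->
    o F = take j (o F) ++ nth v (o F) j :: drop j.+1 (o F).
  by move=> jr; rewrite -drop_nth ?sF // cat_take_drop.
have oF := splitF _ ltj; rewrite nth_index // in oF.
(* Only the deletion of v itself leaves E. *)
rewrite (bigD1 (Ordinal ltj)) //= big1 ?addr0; last first.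
  move=> j /eqP neqj; case: eqP => [defE|]; last by rewrite mulr0.
  case: neqj; apply/val_inj => /=.
  have := splitF j (ltn_ord j) => /supp; rewrite defE => defE'.
  have vj : v = nth v (o F) j.
    apply/eqP; move: vE; rewrite defE' !inE -(mem_ordering ho F) vF andbT.
    by rewrite negbK.
  by rewrite [in RHS]vj index_uniq ?sF ?uniq_ordering.
have FvE : F :\ v = E by rewrite defF setU1K.
have uF := uniq_ordering ho F.
move: oF; set a := take _ _; set b := drop _ _ => oF.
rewrite (supp _ _ _ oF) FvE eqxx.
have -> : index v (o F) = size a by rewrite size_take sF ltj.
have pFE : perm_eq (o F) (v :: o E) by rewrite defF ordering_setU1.
have uvE : uniq (v :: o E) by rewrite -(perm_uniq pFE).
have pEab : perm_eq (o E) (a ++ b).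
  rewrite -(perm_cons v) perm_sym; apply: perm_trans pFE.
  by rewrite oF perm_sym perm_front.
rewrite (incidence_cons R uF pFE) -(@reorder_sign_front _ _ a v b) -?oF //.
rewrite -(@reorder_signM _ _ _ (v :: o E) (v :: a ++ b)) ?perm_cons //.
by rewrite reorder_sign_cons // -mulrA reorder_sign_sqr mulr1.
Qed.

Definition local_mx : 'M[R]_(#|faces K r.+1|, #|local_sets K r.+1|) :=
  \matrix_(i < #|faces K r.+1|, j < #|local_sets K r.+1|)
    if enum_val i \subset enum_val j
    then incidence R (o (enum_val j)) (o (enum_val i)) else 0.

Lemma local_mapE (z : 'rV[R]_#|faces K r.+1|) : local_map o z = z *m local_mx.
Proof.
apply/rowP => j; rewrite !mxE big_mkcond /=; apply: eq_bigr => i _.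
rewrite !mxE; have /facesP[iK ci] := enum_valP i.
rewrite !inE iK ci eqxx andbT /=.
by case: ifP; rewrite ?mulr0 // mulrC.
Qed.

(** * Local numbers and the diagonal *)

Lemma facets_image F : F \in faces K r.+1 ->
  facets K r.+1 F = [set F :\ v | v in F].
Proof.
case/facesP=> FK cF; apply/setP => E; rewrite inE; apply/andP/imsetP.
  case=> /facesP[EK cE] EF; have [v vE defF] := eq_setU1_of_subset EF cE cF.
  by exists v; rewrite defF ?setU11 ?setU1K.
case=> v vF ->; rewrite subD1set; split=> //; apply/facesP; split.
  exact: hK FK (subD1set _ _).
by move: cF; rewrite (cardsD1 v F) vF add1n => -[].
Qed.

Lemma card_facets F : F \in faces K r.+1 -> #|facets K r.+1 F| = r.+2.
Proof.
move=> FK; rewrite facets_image // card_in_imset; first by case/facesP: FK.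
move=> v w vF wF eqF; apply/eqP; rewrite -[_ == _]negbK; apply/negP => vw.
by move/setP/(_ v): eqF; rewrite !inE eqxx vF vw.
Qed.

Let nbhd F := \bigcup_(E in facets K r.+1 F) neighbours K r.+1 E.

Lemma face_subset_nbhd F : F \in faces K r.+1 -> F \subset nbhd F.
Proof.
move=> FK; apply/subsetP => v vF; apply/bigcupP; exists (F :\ v).
  by rewrite facets_image //; apply: imset_f.
rewrite inE setD1K // FK andbT !inE eqxx /=.
by have /facesP[/face_subset_vertices/subsetP/(_ v vF)] := FK; rewrite inE.
Qed.

(** Adding [u] to [F] produces a local set exactly when the enlarged set
    contains a second r-face; such a face is [u] together with a facet of [F]. *)
Lemma local_sets_above F : F \in faces K r.+1 ->
  [set H in local_sets K r.+1 | F \subset H]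
    = [set u |: F | u in nbhd F :\: F].
Proof.
move=> hF; have /facesP[FK cF] := hF.
apply/setP => H; rewrite inE; apply/andP/imsetP.
  case; rewrite inE => /and3P[HV /eqP cH gt1] FH.
  have [u uF defH] := eq_setU1_of_subset FH cF cH.
  have FinH : F \in faces (induced K H) r.+1 by rewrite !inE FK FH cF eqxx.
  have : (0 < #|faces (induced K H) r.+1 :\ F|)%N.
    by move: gt1; rewrite (cardsD1 F) FinH.
  case/card_gt0P=> F'; rewrite !inE => /and3P[neqF /andP[F'K F'H] /eqP cF'].
  have uF' : u \in F'.
    by apply: mem_added_vertex cF cF' neqF _; rewrite -defH.
  have hF' : F' \in faces K r.+1 by apply/facesP.
  exists u => //; rewrite inE uF; apply/bigcupP; exists (F' :\ u).
    have : F' :\ u \in facets K r.+1 F'.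
      by rewrite facets_image //; apply: imset_f.
    rewrite !inE => /andP[-> _] /=; rewrite subDset.
    by move: F'H; rewrite defH.
  rewrite inE setD1K // hF' andbT !inE eqxx /=.
  by have /subsetP/(_ u uF') := face_subset_vertices F'K; rewrite inE.
case=> u; rewrite inE => /andP[uF /bigcupP[E]].
rewrite inE => /andP[/facesP[EK cE] EF].
rewrite inE => /andP[]; rewrite inE => /andP[uE uV] /facesP[uEK cuE] ->.
rewrite subsetUr inE; split=> //; apply/and3P; split.
- by rewrite subUset sub1set uV face_subset_vertices.
- by rewrite cardsU1 uF cF.
have neqF : u |: E != F by apply: contraNneq uF => <-; rewrite setU11.
apply: (@leq_trans #|[set u |: E; F]|); first by rewrite cards2 neqF.
apply/subset_leq_card/subsetP => G; rewrite !inE => /orP[]/eqP->.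
  by rewrite uEK cuE eqxx setUS.
by rewrite FK cF eqxx subsetUr.
Qed.

Lemma local_numberE F : F \in faces K r.+1 ->
  local_number K r.+1 F
    = (#|facets K r.+1 F| + #|[set H in local_sets K r.+1 | F \subset H]|)%N.
Proof.
move=> hF; rewrite card_facets // local_sets_above // card_in_imset.
  rewrite /local_number -/(nbhd F) -(cardsID F) (setIidPr (face_subset_nbhd hF)).
  by case/facesP: hF => _ ->.
move=> u w; rewrite !inE => /andP[uF _] /andP[wF _] /setP/(_ u).
by rewrite !inE eqxx (negbTE uF) !orbF => /esym/eqP.
Qed.

(** * The decomposition of the down Laplacian *)

Lemma sum_incidence_sqr (P : {set {set V}}) (f g : {set V} -> seq V) :
  \sum_(A in P) incidence R (f A) (g A) * incidence R (f A) (g A) = #|P|%:R :> R.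
Proof.
rewrite (eq_bigr (fun=> 1)) ?sumr_const // => A _; exact: incidence_sqr.
Qed.

Lemma down_laplacianE (i j : 'I_#|faces K r.+1|) :
  let F := enum_val i in let F' := enum_val j in
  (boundary R K o r.+1 *m (boundary R K o r.+1)^T) i j
    = \sum_(E in [set E in faces K r | E \subset F :&: F'])
        incidence R (o F) (o E) * incidence R (o F') (o E).
Proof.
move=> F F'; rewrite mxE.
under eq_bigr do rewrite [X in _ * X]mxE !boundaryE.
rewrite -(big_enum_val (A := mem (faces K r))
  (fun E => (if E \subset F then incidence R (o F) (o E) else 0)
          * (if E \subset F' then incidence R (o F') (o E) else 0))).
rewrite big_mkcond [RHS]big_mkcond; apply: eq_bigr => E _ /=.
rewrite [in RHS]inE subsetI; case: (E \in faces K r) => //=.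
by case: (E \subset F); case: (E \subset F'); rewrite ?mul0r ?mulr0.
Qed.

Lemma local_gramE (i j : 'I_#|faces K r.+1|) :
  let F := enum_val i in let F' := enum_val j in
  (local_mx *m local_mx^T) i j
    = \sum_(H in [set H in local_sets K r.+1 | F :|: F' \subset H])
        incidence R (o H) (o F) * incidence R (o H) (o F').
Proof.
move=> F F'; rewrite mxE.
under eq_bigr do rewrite !mxE.
rewrite -(big_enum_val (A := mem (local_sets K r.+1))
  (fun H => (if F \subset H then incidence R (o H) (o F) else 0)
          * (if F' \subset H then incidence R (o H) (o F') else 0))).
rewrite big_mkcond [RHS]big_mkcond; apply: eq_bigr => H _ /=.
rewrite [in RHS]inE subUset; case: (H \in local_sets K r.+1) => //=.
by case: (F \subset H); case: (F' \subset H); rewrite ?mul0r ?mulr0.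
Qed.

Lemma cardsU_cardsI F F' : #|F| = r.+2 -> #|F'| = r.+2 ->
  (#|F :|: F'| == r.+3) = (#|F :&: F'| == r.+1).
Proof.
move=> cF cF'; have := cardsUI F F'; rewrite cF cF' -[in RHS]addSnnS.
by move=> cUI; apply/eqP/eqP => eqc; move: cUI; rewrite eqc => /eqP;
   rewrite ?eqn_add2l ?eqn_add2r => /eqP.
Qed.

(** Distinct r-faces meet in at most as many vertices as a facet has, so a
    common facet can only be the whole intersection; dually, a local set
    containing both can only be their union. *)
Lemma common_facet_set F F' : F \in faces K r.+1 -> F' \in faces K r.+1 ->
  F != F' ->
  [set E in faces K r | E \subset F :&: F']
    = if #|F :&: F'| == r.+1 then [set F :&: F'] else set0.
Proof.
move=> /facesP[FK cF] /facesP[_ cF'] neqF.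
have ltI : (#|F :&: F'| <= r.+1)%N.
  rewrite -ltnS -cF ltn_neqAle subset_leq_card ?subsetIl // andbT.
  apply: contra neqF => /eqP cI; have : F :&: F' == F.
    by rewrite eqEcard subsetIl cI leqnn.
  by move/eqP/setIidPl => sF; rewrite eqEcard sF cF cF' leqnn.
apply/setP => E; rewrite inE; case: ifPn => cI; rewrite !inE.
  apply/andP/eqP => [[/andP[_ /eqP cE] EF]|->].
    by apply/eqP; rewrite eqEcard EF cE (eqP cI) leqnn.
  by rewrite cI (hK FK) ?subsetIl.
apply/negP => /andP[/andP[_ /eqP cE] /subset_leq_card]; rewrite cE => geI.
by rewrite eqn_leq ltI geI in cI.
Qed.

Lemma common_local_set F F' : F \in faces K r.+1 -> F' \in faces K r.+1 ->
  F != F' ->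
  [set H in local_sets K r.+1 | F :|: F' \subset H]
    = if #|F :|: F'| == r.+3 then [set F :|: F'] else set0.
Proof.
move=> /facesP[FK cF] /facesP[F'K cF'] neqF.
have gtU : (r.+3 <= #|F :|: F'|)%N.
  rewrite -cF ltn_neqAle subset_leq_card ?subsetUl // andbT.
  apply: contra neqF => /eqP cU; have : F == F :|: F'.
    by rewrite eqEcard subsetUl -cU leqnn.
  by rewrite eq_sym => /eqP/setUidPl sF; rewrite eq_sym eqEcard sF cF cF' leqnn.
apply/setP => H; rewrite inE; case: ifPn => cU; rewrite !inE.
  apply/andP/eqP => [[/and3P[_ /eqP cH _] UH]|->].
    by apply/eqP; rewrite eq_sym eqEcard UH cH (eqP cU) leqnn.
  rewrite subxx cU subUset !face_subset_vertices //=; split=> //.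
  apply: (@leq_trans #|[set F; F']|); first by rewrite cards2 neqF.
  apply/subset_leq_card/subsetP => G; rewrite !inE => /orP[]/eqP->.
    by rewrite FK cF eqxx subsetUl.
  by rewrite F'K cF' eqxx subsetUr.
apply/negP => /andP[/and3P[_ /eqP cH _] /subset_leq_card]; rewrite cH => leU.
by rewrite eqn_leq gtU leU in cU.
Qed.

Lemma boundary_local_decomposition :
  boundary R K o r.+1 *m (boundary R K o r.+1)^T + local_mx *m local_mx^T
    = diag_mx (\row_i (local_number K r.+1 (enum_val i))%:R).
Proof.
apply/matrixP => i j; rewrite [LHS]mxE down_laplacianE local_gramE 2!mxE.
have hFi := enum_valP i; have hFj := enum_valP j.
have [<-|neq] := eqVneq i j.
  rewrite setIid setUid !sum_incidence_sqr -natrD mulr1n local_numberE //.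
have neqF : enum_val i != enum_val j by rewrite (inj_eq enum_val_inj).
have /facesP[_ cF] := hFi; have /facesP[_ cF'] := hFj.
rewrite mulr0n common_facet_set // common_local_set // cardsU_cardsI //.
case: ifP => [/eqP cI|_]; last by rewrite !big_set0 addr0.
rewrite !big_set1; move: cF cF' cI neqF.
move: (enum_val i) (enum_val j) => F F' cF cF' cI neqF.
have [v vE defF] := eq_setU1_of_subset (subsetIl F F') cI cF.
have [w wE defF'] := eq_setU1_of_subset (subsetIr F F') cI cF'.
have vw : v != w.
  by apply: contra neqF => /eqP eqvw; rewrite defF {2}defF' eqvw setIC.
have defU : F :|: F' = v |: (w |: (F :&: F')).
  by rewrite -defF' {1}defF -setUA; congr (_ :|: _); apply/setUidPr/subsetIr.
have := incidence_square R ho vE wE vw; rewrite /= -defF -defF' => ->.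
by rewrite defU -defF' addNr.
Qed.

End Matrices.

(** * Eigenvalues *)

Lemma row_sqr_eq0 (R : realType) n (x : 'rV[R]_n) :
  (x *m x^T) 0 0 = 0 -> x = 0.
Proof.
rewrite mxE => /eqP; rewrite psumr_eq0 => [/allP x0|i _]; last first.
  by rewrite mxE -expr2 sqr_ge0.
apply/rowP => i; have := x0 i (mem_index_enum i).
by rewrite !mxE mulf_eq0 orbb => /eqP.
Qed.

Lemma row_sqr_ge0 (R : realType) n (x : 'rV[R]_n) : 0 <= (x *m x^T) 0 0.
Proof. by rewrite mxE; apply: sumr_ge0 => i _; rewrite mxE -expr2 sqr_ge0. Qed.

Lemma row_sqr_gt0 (R : realType) n (x : 'rV[R]_n) :
  x != 0 -> 0 < (x *m x^T) 0 0.
Proof.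
move=> x0; rewrite lt_def row_sqr_ge0 andbT.
by apply: contraNneq x0 => /row_sqr_eq0->.
Qed.

(** The transposed matrix maps an eigenvector on one side to an eigenvector on
    the other; its image vanishes only for the eigenvalue zero. *)
Lemma eigenvalue_gram_swap (R : realType) m n (B : 'M[R]_(m, n)) b : b != 0 ->
  eigenvalue (B^T *m B) b <-> eigenvalue (B *m B^T) b.
Proof.
have swap p q (C : 'M[R]_(p, q)) :
    b != 0 -> eigenvalue (C^T *m C) b -> eigenvalue (C *m C^T) b.
  move=> b0 /eigenvalueP[x xb x0]; apply/eigenvalueP; exists (x *m C^T).
    by rewrite mulmxA -(mulmxA x) xb scalemxAl.
  apply: contraNneq x0 => xC; move/eqP: xb; rewrite mulmxA xC mul0mx eq_sym.
  by rewrite scaler_eq0 (negbTE b0).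
move=> b0; split=> [/(swap _ _ _ b0)//|].
by rewrite -{1}[B]trmxK => /(swap _ _ _ b0); rewrite trmxK.
Qed.

(** Pairing an eigenvector with itself in [A + M M^T = diag d] gives
    [b |z|^2 + |z M|^2 = sum_i d_i z_i^2]. Subtracting from [c |z|^2] leaves on
    the right terms that are nonnegative as soon as [c] bounds [d]. *)
Lemma gram_eigenvector_defect (R : realType) m n (A : 'M[R]_m) (M : 'M[R]_(m, n))
    (d z : 'rV[R]_m) (b c : R) :
  A + M *m M^T = diag_mx d -> z *m A = b *: z ->
  (c - b) * (z *m z^T) 0 0
    = (z *m M *m (z *m M)^T) 0 0 + \sum_i (c - d 0 i) * (z 0 i) ^+ 2.
Proof.
move=> dec zA.
have eqD : b * (z *m z^T) 0 0 + (z *m M *m (z *m M)^T) 0 0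
         = \sum_i d 0 i * (z 0 i) ^+ 2.
  transitivity ((z *m diag_mx d *m z^T) 0 0); last first.
    rewrite mul_mx_diag mxE; apply: eq_bigr => i _.
    by rewrite !mxE expr2 mulrA [z 0 i * d 0 i]mulrC.
  by rewrite -dec mulmxDr mulmxDl zA trmx_mul !mulmxA -scalemxAl !mxE.
have zz : (z *m z^T) 0 0 = \sum_i (z 0 i) ^+ 2.
  by rewrite mxE; apply: eq_bigr => i _; rewrite mxE expr2.
under eq_bigr do rewrite mulrBl.
rewrite sumrB -eqD -mulr_sumr -zz mulrBl.
by rewrite [RHS]addrC opprD addrA subrK.
Qed.

Section DiagonalDecomposition.
Variables (R : realType) (m n : nat) (A : 'M[R]_m) (M : 'M[R]_(m, n)).
Variables (d : 'rV[R]_m) (c : R).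
Hypotheses (dec : A + M *m M^T = diag_mx d) (dle : forall i, d 0 i <= c).
Implicit Type z : 'rV[R]_m.

Let defect_ge0 z i : 0 <= (c - d 0 i) * (z 0 i) ^+ 2.
Proof. by rewrite mulr_ge0 ?sqr_ge0 // subr_ge0. Qed.

Lemma gram_eigenvalue_le b : eigenvalue A b -> b <= c.
Proof.
case/eigenvalueP=> z zA z0; rewrite -subr_ge0 -(pmulr_lge0 _ (row_sqr_gt0 z0)).
rewrite (gram_eigenvector_defect c dec zA) addr_ge0 ?row_sqr_ge0 //.
by apply: sumr_ge0 => i _; exact: defect_ge0.
Qed.

(** At [b = c] the defect vanishes, hence so does each of its nonnegative
    terms; conversely [A] acts as [diag d] on the kernel of [M]. *)
Lemma gram_eigenvalue_maxP :
  eigenvalue A c <->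
  exists z, [/\ z != 0, z *m M = 0 & forall i, d 0 i < c -> z 0 i = 0].
Proof.
split=> [/eigenvalueP[z zA z0]|[z [z0 zM zd]]].
  have /eqP := gram_eigenvector_defect c dec zA.
  rewrite subrr mul0r eq_sym paddr_eq0 ?row_sqr_ge0 ?sumr_ge0 // => /andP[].
  move=> /eqP/row_sqr_eq0 zM; rewrite psumr_eq0 // => /allP zd.
  exists z; split=> // i dc; have := zd i (mem_index_enum i).
  by rewrite mulf_eq0 subr_eq0 gt_eqF //= sqrf_eq0 => /eqP.
apply/eigenvalueP; exists z => //.
have -> : A = diag_mx d - M *m M^T by rewrite -dec addrK.
rewrite mulmxBr mulmxA zM mul0mx subr0 mul_mx_diag.
apply/rowP => i; rewrite !mxE mulrC; have [/zd->|] := ltP (d 0 i) c.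
  by rewrite !mulr0.
by move=> cd; rewrite (le_anti (_ : d 0 i <= c <= d 0 i)) // dle.
Qed.

End DiagonalDecomposition.

(** A face of maximal dimension has facets, and their opposite vertices are
    counted in its local number. Positivity matters because passing between
    [B^T B] and [B B^T] only preserves nonzero eigenvalues. *)
Lemma max_local_number_gt0 (V : finType) (K : {set {set V}}) r :
  simplicial_complex K -> dimension K = r.+1 -> (0 < max_local_number K r.+1)%N.
Proof.
move=> hK hdim.
have K0 : (0 < #|K|)%N.
  rewrite lt0n cards_eq0; apply: contra_eq_neq hdim => ->.
  by rewrite /dimension big_set0.
have [F FK dimF] := eq_bigmax_cond (fun F : {set V} => #|F|.-1) K0.
have hF : F \in faces K r.+1.
  apply/facesP; split=> //; move: dimF; rewrite -/(dimension K) hdim.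
  by case: #|F| => // k /= <-.
apply: leq_trans (leq_bigmax_cond _ hF).
by rewrite local_numberE // card_facets.
Qed.

Theorem theorem4p5 (R : realType) (V : finType) (K : {set {set V}})
    (o : {set V} -> seq V) (r : nat)
    (hK : simplicial_complex K) (ho : orderings o)
    (hr : (1 <= r)%N) (hdim : dimension K = r) :
  largest_eigenvalue (up_laplacian R K o r.-1) (max_local_number K r)%:R <->
  exists z : 'rV[R]_#|faces K r|,
    [/\ z <> 0,
        local_map o z = 0
      & forall i : 'I_#|faces K r|,
          (local_number K r (enum_val i) < max_local_number K r)%N -> z 0 i = 0].
Proof.
case: r hr hdim => // r _ hdim /=.
have dec := boundary_local_decomposition R r hK ho.
set d := \row__ _ in dec; set U := max_local_number K r.+1.
have dU i : (d 0 i < U%:R) = (local_number K r.+1 (enum_val i) < U)%N.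
  by rewrite mxE ltr_nat.
have dle i : d 0 i <= U%:R by rewrite mxE ler_nat leq_bigmax_cond ?enum_valP.
have U0 : U%:R != 0 :> R by rewrite pnatr_eq0 -lt0n max_local_number_gt0.
split=> [[/(eigenvalue_gram_swap _ U0) eU _]|[z [/eqP z0 zM zd]]].
  have [z [z0 zM zd]] := (gram_eigenvalue_maxP dec dle).1 eU.
  exists z; split=> [|| i iU]; first exact/eqP.
    by rewrite local_mapE.
  by apply: zd; rewrite dU.
split.
  apply/(eigenvalue_gram_swap _ U0)/(gram_eigenvalue_maxP dec dle).
  by exists z; split=> [||i]; rewrite ?dU -?local_mapE //; apply: zd.
move=> b; have [->|b0] := eqVneq b 0; first by rewrite ler0n.
by move=> /(eigenvalue_gram_swap _ b0)/(gram_eigenvalue_le dec dle).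
Qed.
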